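(* Let $n\ge1$ and let $B_1$ and $B_2$ be two complete sets of Pauli mutually unbiased bases of $(\mathbb{C}^2)^{\otimes n}$. Let $U$ be a unitary operator on $(\mathbb{C}^2)^{\otimes n}$ that maps $B_1$ to $B_2$, i.e. $U$ maps each basis in $B_1$ to a basis in $B_2$ (as sets of states, each vector being considered up to a phase). Then $U$ is in the Clifford group, up to a global phase.
   Context: The $n$-qubit Pauli operators are the $4^n$ tensor products of $n$ factors from $\{I,X,Y,Z\}$ (the identity and the usual $2\times2$ Pauli matrices) acting on $(\mathbb{C}^2)^{\otimes n}$. The Pauli group consists of the Pauli operators multiplied by phases in $\{\pm1,\pm i\}$. The Clifford group is the group of unitaries mapping the Pauli group to itself under conjugation. A complete set of Pauli mutually unbiased bases (Pauli MUB) is obtained as follows: partition the $4^n-1$ non-identity Pauli operators into $2^n+1$ sets, each consisting of $2^n-1$ mutually commuting Pauli operators. The joint eigenstates of the operators in each set form an orthonormal basis of $(\mathbb{C}^2)^{\otimes n}$ (unique up to ordering and phases), and the collection of the $2^n+1$ bases so obtained, which are mutually unbiased, is the complete set of Pauli MUB determined by the partition. $B_1$ and $B_2$ may come from the same or from different partitions. *)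

(* Defs.v *)
From HB Require Import structures.
From mathcomp Require Import all_boot all_order all_algebra.
From mathcomp Require Import spectral.
From mathcomp.real_closed Require Import complex mxtens.
From mathcomp Require Import reals.

Set Implicit Arguments.
Unset Strict Implicit.
Unset Printing Implicit Defensive.

Import Order.TTheory GRing.Theory Num.Theory.
Local Open Scope ring_scope.
Local Open Scope sesquilinear_scope.

Section Defs.
Variable C : numClosedFieldType.

Definition mx22 (a b c d : C) : 'M[C]_2 :=
  \matrix_(i < 2, j < 2)
    if i == ord0 then (if j == ord0 then a else b)
    else (if j == ord0 then c else d).

Definition pauli1 (k : 'I_4) : 'M[C]_2 :=
  nth 0 [:: 1%:M;
            mx22 0 1 1 0;
            mx22 0 (- 'i) 'i 0;
            mx22 1 0 0 (- 1)] k.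

(* The n-fold Kronecker product A 0 (x) A 1 (x) ... (x) A (n-1); the cast only
   identifies the dimension 2 * 2 ^ n with 2 ^ n.+1. *)
Fixpoint tensprod (n : nat) : ('I_n -> 'M[C]_2) -> 'M[C]_(2 ^ n) :=
  match n with
  | 0 => fun=> 1%:M
  | m.+1 => fun A =>
      castmx (esym (expnS 2 m), esym (expnS 2 m))
        (A ord0 *t tensprod (fun i : 'I_m => A (lift ord0 i)))
  end.

(* Pauli operators are indexed by words over {0,1,2,3} = {I,X,Y,Z}; distinct
   words give distinct operators, so sets of operators are sets of words. *)
Definition pauli_word (n : nat) : finType := {ffun 'I_n -> 'I_4}.

Definition pauli_op (n : nat) (w : pauli_word n) : 'M[C]_(2 ^ n) :=
  tensprod (fun i => pauli1 (w i)).

Definition pauli_group (n : nat) (g : 'M[C]_(2 ^ n)) : Prop :=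
  exists (k : 'I_4) (w : pauli_word n), g = 'i ^+ k *: pauli_op w.

(* V conjugates the Pauli group onto itself: the forward implication says
   V G V^* is contained in G, the converse that V^* G V is. *)
Definition clifford (n : nat) (V : 'M[C]_(2 ^ n)) : Prop :=
  V \is unitarymx /\
  forall g : 'M[C]_(2 ^ n), pauli_group g <-> pauli_group (V *m g *m V ^t*).

(* The injectivity of T makes T enumerate 2^n+1 pairwise distinct blocks. *)
Definition pauli_partition (n : nat)
    (T : 'I_(2 ^ n).+1 -> {set pauli_word n}) : Prop :=
  [/\ injective T,
      partition [set T k | k : 'I_(2 ^ n).+1]
                [set w : pauli_word n | pauli_op w != 1%:M],
      forall k, #|T k| = (2 ^ n - 1)%N
    & forall k w1 w2, w1 \in T k -> w2 \in T k ->
        comm_mx (pauli_op w1) (pauli_op w2)].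

(* An orthonormal basis is given by a unitary matrix, whose columns are the
   basis vectors. *)
Definition joint_eigenbasis (n : nat) (S : {set pauli_word n})
    (V : 'M[C]_(2 ^ n)) : Prop :=
  V \is unitarymx /\
  forall w, w \in S -> forall j, exists c : C,
    pauli_op w *m col j V = c *: col j V.

Definition pauli_MUB (n : nat) (B : 'I_(2 ^ n).+1 -> 'M[C]_(2 ^ n)) : Prop :=
  exists T : 'I_(2 ^ n).+1 -> {set pauli_word n},
    pauli_partition T /\ forall k, joint_eigenbasis (T k) (B k).

Definition same_state (d : nat) (u v : 'cV[C]_d) : Prop :=
  exists2 c : C, `|c| = 1 & u = c *: v.

(* The columns of V and those of W form the same set of states. *)
Definition same_basis (d : nat) (V W : 'M[C]_d) : Prop :=
  (forall i, exists j, same_state (col i V) (col j W)) /\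
  (forall j, exists i, same_state (col i V) (col j W)).

Definition maps_bases (I J : Type) (d : nat) (U : 'M[C]_d)
    (B1 : I -> 'M[C]_d) (B2 : J -> 'M[C]_d) : Prop :=
  forall k, exists l, same_basis (U *m B1 k) (B2 l).

End Defs.

(* Main.v *)
(* Adjoining the identity to a class of the partition gives 2^n independent
   Paulis, which span all matrices that are diagonal in the class's basis.  Let
   A, B be Paulis in different classes; then A' = U A U^* and B' = U B U^* are
   combinations of Paulis a_i, b_j from two classes l <> m, and A' B', being
   the image of a Pauli, is diagonal in a third basis r.  The products a_i b_j
   are distinct Paulis, so every one of them occurring in A' B' belongs to
   class r.  If two a_i occurred, their product would be in both classes l and
   r, hence l = r, and then b_j would lie in class l.  So A' is a single Pauli,
   with coefficient +1 or -1: U is itself in the Clifford group. *)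
Require Import Defs.
From HB Require Import structures.
From mathcomp Require Import all_boot all_order all_algebra.
From mathcomp Require Import spectral.
From mathcomp.real_closed Require Import complex mxtens.
From mathcomp Require Import reals.
From mathcomp Require Import ring.

Set Implicit Arguments.
Unset Strict Implicit.
Unset Printing Implicit Defensive.

Import Order.TTheory GRing.Theory Num.Theory.
Local Open Scope ring_scope.

(** * Tensor products of 2 x 2 matrices *)

Section Tensor.
Variable C : numClosedFieldType.

Lemma castmx_mulsq m n (e : m = n) (A B : 'M[C]_m) :
  castmx (e, e) A *m castmx (e, e) B = castmx (e, e) (A *m B).
Proof. by case: n / e. Qed.

Lemma mxtrace_castmx m n (e : m = n) (A : 'M[C]_m) :
  \tr (castmx (e, e) A) = \tr A.
Proof. by case: n / e. Qed.

Lemma mxtrace_tens m n (A : 'M[C]_m) (B : 'M[C]_n) :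
  \tr (A *t B) = \tr A * \tr B.
Proof. by rewrite /mxtrace mulr_sum; apply: eq_bigr => i _; rewrite mxE. Qed.

Lemma tens1mx1 m n : (1%:M : 'M[C]_m) *t (1%:M : 'M[C]_n) = 1%:M.
Proof.
apply/matrixP => i j.
case: (mxtens_indexP i) => i1 i2; case: (mxtens_indexP j) => j1 j2.
rewrite tensmxE !mxE (inj_eq (can_inj (@mxtens_indexK _ _))) xpair_eqE.
by rewrite -natrM mulnb.
Qed.

Lemma tensprod_ext n (A B : 'I_n -> 'M[C]_2) :
  A =1 B -> tensprod A = tensprod B.
Proof.
elim: n A B => [|n IH] A B AB //=.
by rewrite AB (IH _ (fun i => B (lift ord0 i))).
Qed.

Lemma tensprod1 n : tensprod (fun _ : 'I_n => 1%:M) = 1%:M :> 'M[C]_(2 ^ n).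
Proof.
elim: n => [|n IH] //=; rewrite IH tens1mx1.
by apply/matrixP => i j; rewrite castmxE !mxE (inj_eq (@cast_ord_inj _ _ _)).
Qed.

Lemma tensprod_mul n (A B : 'I_n -> 'M[C]_2) :
  tensprod A *m tensprod B = tensprod (fun i => A i *m B i).
Proof.
elim: n A B => [|n IH] A B /=; first by rewrite mulmx1.
by rewrite castmx_mulsq tensmx_mul IH.
Qed.

Lemma mxtrace_tensprod n (A : 'I_n -> 'M[C]_2) :
  \tr (tensprod A) = \prod_i \tr (A i).
Proof.
elim: n A => [|n IH] A /=; first by rewrite big_ord0 mxtrace1.
by rewrite mxtrace_castmx mxtrace_tens IH big_ord_recl.
Qed.

Lemma tensprod_scale n (c : 'I_n -> C) (A : 'I_n -> 'M[C]_2) :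
  tensprod (fun i => c i *: A i) = (\prod_i c i) *: tensprod A.
Proof.
elim: n c A => [|n IH] c A /=; first by rewrite big_ord0 scale1r.
rewrite IH big_ord_recl; apply/matrixP => i j.
by rewrite [RHS]mxE !castmxE !mxE mulrACA.
Qed.

End Tensor.

(** * Products and trace orthogonality of Pauli operators *)

Section Pauli.
Variable C : numClosedFieldType.

Lemma pauli1_mul (a b : 'I_4) : exists (kl : 'I_4 * 'I_4),
  pauli1 C a *m pauli1 C b = 'i ^+ kl.1 *: pauli1 C kl.2.
Proof.
have ii : 'i * 'i = -1 :> C by rewrite -expr2 sqrCi.
(* For distinct a, b among 1, 2, 3 the third index is 6 - a - b, since 1 + 2 + 3 = 6. The phase is i
   in the cyclic orders XY, YZ, ZX, and i^3 = -i otherwise. *)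
pose l := (if val a == 0 then val b else if val b == 0 then val a
  else if val a == val b then 0 else 6 - a - b)%N.
pose k := (if [|| val a == 0, val b == 0 | val a == val b] then 0
  else if (val b == a.+1) || (val a == b.+2) then 1 else 3)%N.
exists (inord k, inord l); rewrite {}/k {}/l.
case: a => -[|[|[|[|//]]]] ?; case: b => -[|[|[|[|//]]]] ?;
  rewrite /pauli1 /= !inordK //= ?mul1mx ?mulmx1 ?expr0 ?scale1r //;
  apply/matrixP => i j; rewrite !mxE !big_ord_recl big_ord0 /= !mxE;
  case: i => -[|[|//]] ?; case: j => -[|[|//]] ? /=; rewrite ?mulr1n ?mulr0n;
  ring: ii.
Qed.

Lemma pauli1_sq (a : 'I_4) : pauli1 C a *m pauli1 C a = 1%:M.
Proof.
have ii : 'i * 'i = -1 :> C by rewrite -expr2 sqrCi.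
case: a => -[|[|[|[|//]]]] ?; rewrite /pauli1 /= ?mulmx1 //;
  apply/matrixP => i j; rewrite !mxE !big_ord_recl big_ord0 /= !mxE;
  case: i => -[|[|//]] ?; case: j => -[|[|//]] ? /=; rewrite ?mulr1n ?mulr0n;
  ring: ii.
Qed.

Lemma mxtrace_pauli1 (a b : 'I_4) :
  \tr (pauli1 C a *m pauli1 C b) = if a == b then 2 else 0.
Proof.
have [<-|nab] := eqVneq a b; first by rewrite pauli1_sq mxtrace1.
move: nab; rewrite -val_eqE.
case: a => -[|[|[|[|//]]]] ?; case: b => -[|[|[|[|//]]]] ? //= _;
  rewrite /pauli1 /= /mxtrace !big_ord_recl !big_ord0 /= !mxE
    !big_ord_recl !big_ord0 /= !mxE /= ?mulr1n ?mulr0n; ring.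
Qed.

Variable n : nat.
Implicit Types u v w : pauli_word n.
Local Notation P := (@pauli_op C n).

Lemma pauli_sq w : P w *m P w = 1%:M.
Proof.
rewrite /pauli_op tensprod_mul -[RHS]tensprod1; apply: tensprod_ext => i.
exact: pauli1_sq.
Qed.

(** Traces multiply over tensor factors, and a position where the words differ contributes 0. *)
Lemma mxtrace_pauli u v :
  \tr (P u *m P v) = if u == v then (2 ^ n)%:R else 0.
Proof.
rewrite /pauli_op tensprod_mul mxtrace_tensprod.
have [->|/eqP uv] := eqVneq u v.
  under eq_bigr do rewrite pauli1_sq mxtrace1.
  by rewrite prodr_const card_ord natrX.
have [i /negPf uvi] : exists i, u i != v i.
  apply/existsP; apply: contra_notT uv => /existsPn uv.
  by apply/ffunP => i; apply/eqP; rewrite -[_ == _]negbK.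
by rewrite (bigD1 i) //= mxtrace_pauli1 uvi mul0r.
Qed.

Lemma pauli_mul u v :
  exists (k : nat) w, P u *m P v = 'i ^+ k *: P w.
Proof.
have [f Hf] := fin_all_exists (fun i => pauli1_mul (u i) (v i)).
exists (\sum_i (f i).1)%N, [ffun i => (f i).2].
rewrite /pauli_op tensprod_mul (tensprod_ext Hf) tensprod_scale expr_sum.
by congr (_ *: _); apply: tensprod_ext => i; rewrite ffunE.
Qed.

Lemma expCi_neq0 (k : nat) : 'i ^+ k != 0 :> C.
Proof. by rewrite expf_neq0 // neq0Ci. Qed.

Lemma expCi_mod4 (k : nat) : 'i ^+ k = 'i ^+ (k %% 4) :> C.
Proof.
have i4E : 'i ^+ 4 = 1 :> C by rewrite (exprM _ 2 2) sqrCi sqrrN expr1n.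
by rewrite {1}(divn_eq k 4) exprD mulnC exprM i4E expr1n mul1r.
Qed.

(** Phases are carried with exponents in [nat]; this returns them to ['I_4]. *)
Lemma pauli_group_exp (k : nat) w : pauli_group ('i ^+ k *: P w).
Proof.
by exists (inord (k %% 4)), w; rewrite inordK ?ltn_mod // -expCi_mod4.
Qed.

Lemma dim_neq0 : (2 ^ n)%:R != 0 :> C.
Proof. by rewrite pnatr_eq0 expn_eq0. Qed.

Definition pauli_id : pauli_word n := [ffun=> ord0].

Lemma pauli_op_id : P pauli_id = 1%:M.
Proof.
by rewrite -(tensprod1 C n); apply: tensprod_ext => i; rewrite ffunE.
Qed.

(** If P v P u = c P w, then P u P v, being its inverse, is c^-1 P w, because Paulis square to 1.
    The scalar stays unspecified, as diagonality ignores scaling. *)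
Lemma pauli_comm u v : exists c : C, P u *m P v = c *: (P v *m P u).
Proof.
have [k [w E]] := pauli_mul v u; set c := 'i ^+ k in E.
have c0 : c != 0 by exact: expCi_neq0.
have Ew : P w = c^-1 *: (P v *m P u) by rewrite E scalerA mulVf // scale1r.
exists (c^-1 * c^-1); rewrite -scalerA -Ew.
have <- : (P u *m P v) *m (P v *m P u) *m (c^-1 *: P w) = P u *m P v.
  rewrite E -mulmxA -scalemxAl -!scalemxAr scalerA mulfV // scale1r.
  by rewrite pauli_sq mulmx1.
by rewrite mulmxA -(mulmxA (P u)) pauli_sq mulmx1 pauli_sq mul1mx.
Qed.

Lemma mxtrace_pauli_neq0 u v : \tr (P u *m P v) != 0 -> u = v.
Proof. by rewrite mxtrace_pauli; case: (u =P v) => //; rewrite eqxx. Qed.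

End Pauli.

(** * Matrices diagonal in a basis and their Pauli expansions *)

Section DiagonalIn.
Variable C : numClosedFieldType.

Definition diag_in d (V M : 'M[C]_d) : Prop :=
  forall j, exists c : C, M *m col j V = c *: col j V.

(** Names the eigenvalues that [diag_in V M] only asserts to exist; it is meant for invertible V and
    M diagonal in V. *)
Definition eigval d (V M : 'M[C]_d) : 'rV[C]_d :=
  \row_j (invmx V *m M *m V) j j.

Lemma diag_in_eigval d (V M : 'M[C]_d) : V \in unitmx -> diag_in V M ->
  M *m V = V *m diag_mx (eigval V M).
Proof.
move=> uV MV; apply: (canRL (mulKVmx uV)).
apply/matrixP => i j; have [c Mc] := MV j.
have E (k : 'I_d) : (invmx V *m M *m V) k j = c *+ (k == j).
  have -> : (invmx V *m M *m V) k j = (invmx V *m (M *m col j V)) k 0.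
    by rewrite colE !mulmxA -colE [RHS]mxE.
  by rewrite Mc -scalemxAr colE mulmxA mulVmx // -colE !mxE mulr_natr.
have Ej : eigval V M 0 j = c by rewrite mxE E eqxx.
by rewrite mulmxA E [RHS]mxE; case: eqP => [->|//]; rewrite Ej.
Qed.

Lemma diag_in_mul d (V M N : 'M[C]_d) :
  diag_in V M -> diag_in V N -> diag_in V (M *m N).
Proof.
move=> MV NV j; have [a Ma] := MV j; have [b Nb] := NV j.
by exists (b * a); rewrite -mulmxA Nb -scalemxAr Ma scalerA.
Qed.

Lemma diag_in_scale d (V M : 'M[C]_d) (a : C) :
  diag_in V M -> diag_in V (a *: M).
Proof.
move=> MV j; have [c Mc] := MV j; exists (a * c).
by rewrite -scalemxAl Mc scalerA.
Qed.

Lemma diag_in1 d (V : 'M[C]_d) : diag_in V 1%:M.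
Proof. by move=> j; exists 1; rewrite mul1mx scale1r. Qed.

Lemma diag_in_mxtrace d (V M N : 'M[C]_d) : V \in unitmx ->
  diag_in V M -> diag_in V N ->
  \tr (M *m N) = \sum_j eigval V M 0 j * eigval V N 0 j.
Proof.
move=> uV MV NV.
have -> : M *m N =
    V *m (diag_mx (eigval V M) *m diag_mx (eigval V N) *m invmx V).
  rewrite !mulmxA -diag_in_eigval // -(mulmxA M) -diag_in_eigval //.
  by rewrite !mulmxA mulmxK.
rewrite mxtrace_mulC mulmxKV // mulmx_diag mxtrace_diag.
by apply: eq_bigr => j _; rewrite mxE.
Qed.

Variable n : nat.
Implicit Types (u v w : pauli_word n) (S : {set pauli_word n}).
Local Notation P := (@pauli_op C n).

(** Coordinate along [P w] for the trace form, where distinct Paulis are orthogonal and each has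
    square 2^n. *)
Definition coef w (M : 'M[C]_(2 ^ n)) : C := \tr (P w *m M) / (2 ^ n)%:R.

Lemma coef_mxtrace_neq0 w M : (coef w M != 0) = (\tr (P w *m M) != 0).
Proof. by rewrite mulf_eq0 invr_eq0 (negPf (dim_neq0 C n)) orbF. Qed.

Lemma coef_pauli w v : coef w (P v) = (w == v)%:R.
Proof.
by rewrite /coef mxtrace_pauli; case: eqP; rewrite ?mul0r // divff ?dim_neq0.
Qed.

Lemma coef_sum I (r : seq I) (p : pred I) w (F : I -> 'M[C]_(2 ^ n)) :
  coef w (\sum_(i <- r | p i) F i) = \sum_(i <- r | p i) coef w (F i).
Proof. by rewrite /coef mulmx_sumr raddf_sum mulr_suml. Qed.

Lemma coef_scale w a M : coef w (a *: M) = a * coef w M.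
Proof. by rewrite /coef -scalemxAr mxtraceZ mulrA. Qed.

(** Models a partition class with the identity adjoined, so that its size equals the dimension. *)
Definition stabilizes S (V : 'M[C]_(2 ^ n)) : Prop :=
  [/\ V \in unitmx, #|S| = (2 ^ n)%N & forall w, w \in S -> diag_in V (P w)].

(* The 2^n Paulis of S are linearly independent, so they span the
   2^n-dimensional space of matrices that are diagonal in V. *)
Lemma diag_in_expand S V M : stabilizes S V -> diag_in V M ->
  M = \sum_(w in S) coef w M *: P w.
Proof.
move=> [uV cS SV] MV.
(* The rows are the eigenvalue vectors of the Paulis in S. Trace orthogonality gives D D^T = 2^n I,
   so they span all eigenvalue vectors. *)
pose D := \matrix_(s < #|S|, j < 2 ^ n) eigval V (P (enum_val s)) 0 j.
have DD : D *m D^T = (2 ^ n)%:R%:M.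
  apply/matrixP => s t; rewrite !mxE.
  under eq_bigr do rewrite !mxE.
  have := diag_in_mxtrace uV (SV _ (enum_valP s)) (SV _ (enum_valP t)).
  under [X in _ = X -> _]eq_bigr do rewrite !mxE.
  move=> <-; rewrite mxtrace_pauli (inj_eq enum_val_inj).
  by case: eqP.
have fD : row_full D.
  rewrite /row_full eqn_leq rank_leq_col -{1}cS /=.
  apply: leq_trans (mxrankM_maxl D D^T); rewrite DD.
  by rewrite -scalemx1 mxrank_scale_nz ?dim_neq0 // mxrank1.
have /submxP[c Ec] := submx_full (eigval V M) fD.
have EM : M = \sum_s c 0 s *: P (enum_val s).
  apply: (can_inj (mulmxK uV)); rewrite (diag_in_eigval uV MV) Ec mulmx_suml.
  have -> : diag_mx (c *m D) =
      \sum_s c 0 s *: diag_mx (eigval V (P (enum_val s))).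
    apply/matrixP => i j; rewrite summxE [LHS]mxE [X in X *+ _]mxE -sumrMnl.
    apply: eq_bigr => s _.
    by rewrite [D _ _]mxE [RHS]mxE [X in _ = _ * X]mxE mulrnAr.
  rewrite mulmx_sumr; apply: eq_bigr => s _.
  by rewrite -scalemxAr -scalemxAl (diag_in_eigval uV (SV _ (enum_valP s))).
(* Orthogonality identifies the coordinates [c] with [coef]. *)
rewrite [LHS]EM [RHS]big_enum_val.
apply: eq_bigr => s _; congr (_ *: _).
rewrite [in RHS]EM coef_sum (bigD1 s) //= coef_scale coef_pauli eqxx mulr1.
rewrite big1 ?addr0 // => t ts.
by rewrite coef_scale coef_pauli (inj_eq enum_val_inj) eq_sym (negPf ts) mulr0.
Qed.

Lemma coef_supp S V M w :
  stabilizes S V -> diag_in V M -> coef w M != 0 -> w \in S.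
Proof.
move=> SV MV; apply: contraR => wS.
rewrite (diag_in_expand SV MV) coef_sum big1 // => v vS.
rewrite coef_scale coef_pauli; case: eqP => [wv|]; last by rewrite mulr0.
by rewrite wv vS in wS.
Qed.

Lemma pauli_op_inj : injective P.
Proof.
move=> u v uv; apply: (@mxtrace_pauli_neq0 C).
by rewrite uv pauli_sq mxtrace1 dim_neq0.
Qed.

(** Maximality of S: membership becomes diagonality in V, which passes through products and
    conjugation. *)
Lemma stabilizes_pauli S V w : stabilizes S V -> diag_in V (P w) -> w \in S.
Proof.
move=> SV wV; apply: (coef_supp SV wV).
by rewrite coef_pauli eqxx oner_neq0.
Qed.

Lemma stabilizes_scaled S V w (k : nat) :
  stabilizes S V -> diag_in V ('i ^+ k *: P w) -> w \in S.
Proof.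
move=> SV wV; apply: (coef_supp SV wV).
by rewrite coef_scale coef_pauli eqxx mulr1 expCi_neq0.
Qed.

(** Disjointness of two classes, once the identity has been adjoined to both. *)
Definition meet1 S (T : {set pauli_word n}) :=
  forall w, w \in S -> w \in T -> P w = 1%:M.

(** Expand M over S: a Pauli of S with nonzero trace against N lies in T too, so only the identity
    term survives. For projectors onto vectors of two orthonormal bases this is mutual
    unbiasedness. *)
Lemma mxtrace_meet1 S T V W M N : stabilizes S V -> stabilizes T W ->
  meet1 S T -> diag_in V M -> diag_in W N ->
  \tr (M *m N) = \tr M * \tr N / (2 ^ n)%:R.
Proof.
move=> SV TW ST MV NW; have d0 := dim_neq0 C n.
rewrite {1}(diag_in_expand SV MV) mulmx_suml raddf_sum /=.
have oneS : pauli_id n \in S.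
  by apply: (stabilizes_pauli SV); rewrite pauli_op_id; exact: diag_in1.
rewrite (bigD1 _ oneS) /= big1 ?addr0 => [|s /andP[sS s1]].
  rewrite -scalemxAl mxtraceZ pauli_op_id mul1mx /coef pauli_op_id mul1mx.
  by rewrite mulrAC.
rewrite -scalemxAl mxtraceZ; apply/eqP; rewrite mulf_eq0; apply/orP; right.
rewrite -[_ == 0]negbK -coef_mxtrace_neq0; apply: contra s1 => sN.
apply/eqP/pauli_op_inj; rewrite pauli_op_id; apply: ST => //.
exact: coef_supp NW sN.
Qed.

(* Up to a scalar, the coefficient of A B on the Pauli proportional to b a is
   tr ((a A) (B b)), which factors as tr (a A) * tr (B b) by mxtrace_meet1. *)
Lemma supp_prod S1 S2 S3 V1 V2 V3 A B a b :
  stabilizes S1 V1 -> stabilizes S2 V2 -> stabilizes S3 V3 -> meet1 S1 S2 ->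
  diag_in V1 A -> diag_in V2 B -> diag_in V3 (A *m B) ->
  coef a A != 0 -> coef b B != 0 -> diag_in V3 (P b *m P a).
Proof.
move=> SV1 SV2 SV3 S12 AV BV ABV aA bB.
have [k [u E]] := pauli_mul C b a; rewrite E; apply: diag_in_scale.
suff uS : u \in S3 by case: SV3 => _ _; apply.
have aS := coef_supp SV1 AV aA; have bS := coef_supp SV2 BV bB.
apply: (coef_supp SV3 ABV); rewrite coef_mxtrace_neq0.
have : \tr (P b *m P a *m (A *m B)) != 0.
  rewrite -mulmxA mxtrace_mulC !mulmxA -(mulmxA (P a *m A)).
  have [_ _ PV1] := SV1; have [_ _ PV2] := SV2.
  rewrite (mxtrace_meet1 SV1 SV2 S12) ?mulf_neq0 ?invr_neq0 ?dim_neq0 //.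
  - by rewrite -coef_mxtrace_neq0.
  - by rewrite mxtrace_mulC -coef_mxtrace_neq0.
  - by apply: diag_in_mul => //; exact: PV1.
  - by apply: diag_in_mul => //; exact: PV2.
by rewrite E -scalemxAl mxtraceZ mulf_eq0 negb_or => /andP[].
Qed.

(* If a1 <> a2, then b a1 and b a2 lie in S3, hence so does their product
   a1 a2, which is a nontrivial element of S1; so S3 = S1, and then b, being
   proportional to (b a1) a1, lies in both S1 and S2. *)
Lemma supp_unique S1 S2 S3 V1 V2 V3 A B a1 a2 b :
  stabilizes S1 V1 -> stabilizes S2 V2 -> stabilizes S3 V3 -> meet1 S1 S2 ->
  V3 = V1 \/ meet1 S1 S3 ->
  diag_in V1 A -> diag_in V2 B -> diag_in V3 (A *m B) ->
  coef b B != 0 -> P b != 1%:M -> coef a1 A != 0 -> coef a2 A != 0 -> a1 = a2.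
Proof.
move=> SV1 SV2 SV3 S12 S13 AV BV ABV bB b1 aA1 aA2.
have ba1 := supp_prod SV1 SV2 SV3 S12 AV BV ABV aA1 bB.
have ba2 := supp_prod SV1 SV2 SV3 S12 AV BV ABV aA2 bB.
have [_ _ PV1] := SV1.
have aV1 := PV1 _ (coef_supp SV1 AV aA1).
have aV2 := PV1 _ (coef_supp SV1 AV aA2).
case: S13 => [V31|S13].
  rewrite V31 in ba1; case/eqP: b1; apply: S12; last exact: coef_supp BV bB.
  apply: (stabilizes_pauli SV1).
  by rewrite -[P b]mulmx1 -(pauli_sq C a1) mulmxA; exact: diag_in_mul.
have a12 : diag_in V3 (P a1 *m P a2).
  have -> : P a1 *m P a2 = P a1 *m P b *m (P b *m P a2).
    by rewrite mulmxA -(mulmxA (P a1)) pauli_sq mulmx1.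
  apply: diag_in_mul => //; have [c ->] := pauli_comm C a1 b.
  exact: diag_in_scale.
have [k [v E]] := pauli_mul C a1 a2.
have v1 : P v = 1%:M.
  apply: S13.
    by apply: (@stabilizes_scaled _ V1 _ k SV1); rewrite -E; exact: diag_in_mul.
  by apply: (@stabilizes_scaled _ V3 _ k SV3); rewrite -E.
apply: (@mxtrace_pauli_neq0 C).
by rewrite E v1 mxtraceZ mxtrace1 mulf_neq0 ?expCi_neq0 ?dim_neq0.
Qed.

Lemma coef_exists S V M : stabilizes S V -> diag_in V M -> M != 0 ->
  exists w, coef w M != 0.
Proof.
move=> SV MV M0; apply/existsP; apply: contraNT M0 => /existsPn M0.
rewrite (diag_in_expand SV MV) big1 // => w _.
by have /negPn/eqP-> := M0 w; rewrite scale0r.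
Qed.

End DiagonalIn.

(** * Classes of a Pauli partition *)

Section MUB.
Variables (C : numClosedFieldType) (n : nat).
Local Open Scope sesquilinear_scope.
Local Notation P := (@pauli_op C n).
Local Notation stab T := (pauli_id n |: T).

Variables (T : 'I_(2 ^ n).+1 -> {set pauli_word n}).
Hypothesis partT : pauli_partition C T.

Lemma pauli_partition_neq1 k w : w \in T k -> P w != 1%:M.
Proof.
have [_ /and3P[/eqP cT _ _] _ _] := partT => wT.
suff : w \in cover [set T k | k : 'I_(2 ^ n).+1] by rewrite cT inE.
by apply/bigcupP; exists (T k) => //; apply: imset_f.
Qed.

Lemma pauli_partition_cover w : exists k, w \in stab (T k).
Proof.
have [w1|w1] := eqVneq (P w) 1%:M.
  exists ord0; rewrite !inE; apply/orP; left; apply/eqP/(@pauli_op_inj C).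
  by rewrite pauli_op_id.
have [_ /and3P[/eqP cT _ _] _ _] := partT.
have : w \in cover [set T k | k : 'I_(2 ^ n).+1] by rewrite cT inE.
by case/bigcupP => _ /imsetP[k _ ->] wT; exists k; rewrite inE wT orbT.
Qed.

Lemma pauli_partition_meet1 k l : k != l -> meet1 C (stab (T k)) (stab (T l)).
Proof.
move=> kl w; rewrite !inE => /orP[/eqP-> _|wk]; first exact: pauli_op_id.
move=> /orP[/eqP->|wl]; first exact: pauli_op_id.
have [Tinj /and3P[_ /trivIsetP tT _] _ _] := partT.
have /pred0P/(_ w) := tT _ _ (imset_f T (isT : k \in 'I_(2 ^ n).+1))
  (imset_f T (isT : l \in 'I_(2 ^ n).+1)) (contra_neq (@Tinj k l) kl).
by rewrite /= wk wl.
Qed.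

Lemma pauli_partition_stabilizes k (V : 'M[C]_(2 ^ n)) :
  joint_eigenbasis (T k) V -> stabilizes (stab (T k)) V.
Proof.
have [_ _ cT _] := partT => -[uV TV]; split.
- exact: unitarymx_unit.
- rewrite cardsU1 cT subn1; case: (boolP (_ \in _)) => [/pauli_partition_neq1|_].
    by rewrite pauli_op_id eqxx.
  by rewrite /= add1n prednK // expn_gt0.
- move=> w; rewrite inE => /orP[/set1P->|/TV //].
  by rewrite pauli_op_id; exact: diag_in1.
Qed.

(** Positivity of n enters here: for n = 0 a class has 2^0 - 1 = 0 elements. *)
Lemma pauli_partition_nontrivial k : (0 < n)%N ->
  exists2 w, w \in T k & P w != 1%:M.
Proof.
move=> n_gt0; have [_ _ cT _] := partT.
have /card_gt0P[w wT] : (0 < #|T k|)%N.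
  by rewrite cT subn_gt0 -{1}(expn0 2) ltn_exp2l.
by exists w => //; exact: pauli_partition_neq1 wT.
Qed.

End MUB.

(** * Conjugation by a unitary *)

Section Conjugation.
Variable C : numClosedFieldType.
Local Open Scope sesquilinear_scope.

Lemma same_basis_diag_in d (V W M : 'M[C]_d) :
  same_basis V W -> diag_in V M <-> diag_in W M.
Proof.
move=> [VW WV]; split => MV j.
  have [i [c c1 E]] := WV j; have [m Mm] := MV i; exists m.
  have c0 : c != 0 by rewrite -normr_eq0 c1 oner_neq0.
  apply: (scalerI c0).
  by rewrite scalemxAr -E Mm E !scalerA mulrC.
have [i [c c1 E]] := VW j; have [m Mm] := MV i; exists m.
by rewrite E -scalemxAr Mm !scalerA mulrC.
Qed.

Variables (d : nat) (U : 'M[C]_d).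
Hypothesis Uunit : U \is unitarymx.

Definition conj M := U *m M *m U^t*.

Let UtU : U^t* *m U = 1%:M.
Proof. by rewrite -invmx_unitary // mulVmx // unitarymx_unit. Qed.

Lemma conj_mul M N : conj (M *m N) = conj M *m conj N.
Proof. by rewrite /conj !mulmxA -(mulmxA (U *m M) _ U) UtU mulmx1. Qed.

Lemma conj1 : conj 1%:M = 1%:M.
Proof. by rewrite /conj mulmx1 (unitarymxP Uunit). Qed.

Lemma conj_scale a M : conj (a *: M) = a *: conj M.
Proof. by rewrite /conj -scalemxAr -scalemxAl. Qed.

Lemma conj_inj : injective conj.
Proof.
apply: (can_inj (g := fun M => U^t* *m M *m U)) => M.
by rewrite /conj !mulmxA UtU mul1mx -mulmxA UtU mulmx1.
Qed.

Lemma mxtrace_conj M : \tr (conj M) = \tr M.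
Proof. by rewrite /conj mxtrace_mulC mulmxA UtU mul1mx. Qed.

Lemma diag_in_conj V M : diag_in V M <-> diag_in (U *m V) (conj M).
Proof.
have E j : conj M *m col j (U *m V) = U *m (M *m col j V).
  by rewrite /conj !colE !mulmxA -(mulmxA _ _ U) UtU mulmx1.
have Ec j : col j (U *m V) = U *m col j V by rewrite !colE mulmxA.
split => MV j; have [c Mc] := MV j; exists c.
  by rewrite E Mc -scalemxAr Ec.
apply: (can_inj (mulKmx (unitarymx_unit Uunit))).
by rewrite -E Mc Ec scalemxAr.
Qed.

(** Left to right, this places images of Paulis in bases of [B2]; right to left, it shows that
    distinct bases have distinct images. *)
Lemma maps_basis_diag_in V W M :
  same_basis (U *m V) W -> diag_in V M <-> diag_in W (conj M).
Proof. by move=> UVW; rewrite diag_in_conj; exact: same_basis_diag_in. Qed.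

End Conjugation.

(** * Unitaries carrying one Pauli MUB to another *)

Section Main.
Variables (C : numClosedFieldType) (n : nat) (n_gt0 : (0 < n)%N).
Local Open Scope sesquilinear_scope.
Local Notation P := (@pauli_op C n).
Variables B1 B2 : 'I_(2 ^ n).+1 -> 'M[C]_(2 ^ n).
Hypotheses (hB1 : pauli_MUB B1) (hB2 : pauli_MUB B2).
Variable U : 'M[C]_(2 ^ n).
Hypotheses (hU : U \is unitarymx) (hUB : maps_bases U B1 B2).

Lemma conj_pauli w : exists (k : nat) v, conj U (P w) = 'i ^+ k *: P v.
Proof.
have [T1 [pT1 eT1]] := hB1; have [T2 [pT2 eT2]] := hB2.
have sB1 k := pauli_partition_stabilizes pT1 (eT1 k).
have sB2 k := pauli_partition_stabilizes pT2 (eT2 k).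
have [k wk] := pauli_partition_cover pT1 w.
have [k' kk'] : exists k', k != k'.
  have [->|k0] := eqVneq k ord0; last by exists ord0.
  by exists ord_max; rewrite -val_eqE /= eq_sym -lt0n expn_gt0.
have [b bk' b1] := pauli_partition_nontrivial pT1 k' n_gt0.
have bS : b \in pauli_id n |: T1 k' by rewrite inE bk' orbT.
have [l Ul] := hUB k; have [l' Ul'] := hUB k'.
have wV : diag_in (B1 k) (P w) by have [_ _] := sB1 k; apply.
have bV : diag_in (B1 k') (P b) by have [_ _] := sB1 k'; apply.
have AV : diag_in (B2 l) (conj U (P w)) by apply/(maps_basis_diag_in hU _ Ul).
have BV : diag_in (B2 l') (conj U (P b)) by apply/(maps_basis_diag_in hU _ Ul').
(* [maps_bases] does not assert injectivity. If l = l', pulling back makes b diagonal in [B1 k] as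
   well, so b lies in two classes and is the identity. *)
have ll' : l != l'.
  apply: contra_neqN b1 => /eqP ll'; rewrite -ll' in BV.
  apply: (pauli_partition_meet1 pT1 kk') => //.
  by apply: (stabilizes_pauli (sB1 k)); apply/(maps_basis_diag_in hU _ Ul).
have [j [u E]] := pauli_mul C w b.
have [r ur] := pauli_partition_cover pT1 u.
have [m Um] := hUB r.
have ABV : diag_in (B2 m) (conj U (P w) *m conj U (P b)).
  rewrite -conj_mul // E conj_scale; apply: diag_in_scale.
  by apply/(maps_basis_diag_in hU _ Um); have [_ _] := sB1 r; apply.
have conj_neq0 v : conj U (P v) != 0.
  apply: contra_neq (oner_neq0 C) => E0.
  have : conj U (P v *m P v) = 0 by rewrite conj_mul // E0 mulmx0.
  rewrite pauli_sq conj1 // => /(congr1 mxtrace).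
  by rewrite mxtrace1 mxtrace0 => /eqP; rewrite (negPf (dim_neq0 C n)).
have [a aA] := coef_exists (sB2 l) AV (conj_neq0 w).
have [c cB] := coef_exists (sB2 l') BV (conj_neq0 b).
(* Conjugation preserves the trace, and b is traceless, so the identity does not occur in its
   image. *)
have c1 : P c != 1%:M.
  apply: contra_neq b1 => c1; rewrite -(pauli_op_id C n); congr P.
  apply: (@mxtrace_pauli_neq0 C); move: cB.
  by rewrite coef_mxtrace_neq0 c1 mul1mx mxtrace_conj // pauli_op_id mulmx1.
have S12 := pauli_partition_meet1 pT2 ll'.
(* At this point m = l is not excluded; [supp_unique] treats both cases. *)
have S13 : B2 m = B2 l \/ meet1 C (pauli_id n |: T2 l) (pauli_id n |: T2 m).
  have [->|lm] := eqVneq l m; first by left.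
  by right; exact: pauli_partition_meet1.
have EA : conj U (P w) = coef a (conj U (P w)) *: P a.
  rewrite {1}(diag_in_expand (sB2 l) AV) (bigD1 a) /=; last first.
    exact: coef_supp AV aA.
  rewrite big1 ?addr0 // => a' /andP[_ aa'].
  have [->|aA'] := eqVneq (coef a' (conj U (P w))) 0; first by rewrite scale0r.
  case/eqP: aa'.
  exact: (supp_unique (sB2 l) (sB2 l') (sB2 m) S12 S13 AV BV ABV cB c1 aA' aA).
(* The image squares to 1, so its coefficient x satisfies x^2 = 1, giving the phases i^0 and i^2. *)
have : conj U (P w *m P w) = 1%:M by rewrite pauli_sq conj1.
rewrite conj_mul // EA; move: (coef a _) => x.
rewrite -scalemxAl -scalemxAr scalerA pauli_sq => /(congr1 mxtrace).
rewrite mxtraceZ mxtrace1 => /(canRL (mulfK (dim_neq0 C n))).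
rewrite divff ?dim_neq0 // -expr2 => /eqP; rewrite sqrf_eq1.
by case/orP => /eqP->; [exists 0, a; rewrite expr0 | exists 2, a; rewrite sqrCi].
Qed.

(** For the converse inclusion, the induced map F on words is injective because conjugation
    preserves tr (P u P v); finiteness makes it bijective. *)
Lemma maps_bases_clifford : clifford U.
Proof.
split=> //.
have [f Hf] := fin_all_exists conj_pauli.
have [F HF] := fin_all_exists Hf.
have Finj : injective F.
  move=> u v Fuv; apply: (@mxtrace_pauli_neq0 C).
  rewrite -(mxtrace_conj hU) conj_mul // !HF Fuv -scalemxAl -scalemxAr.
  by rewrite pauli_sq !mxtraceZ mxtrace1 !mulf_neq0 ?expCi_neq0 ?dim_neq0.
move=> g; split=> [[k [w ->]]|[k [w Eg]]].
  rewrite -/(conj U _) conj_scale HF scalerA -exprD; exact: pauli_group_exp.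
have [G _ GK] := injF_bij Finj.
(* The exponent 3 f cancels the phase i^f of the image, since 3 f + f is a multiple of 4. *)
have E : conj U ('i ^+ (3 * f (G w)) *: P (G w)) = P w.
  rewrite conj_scale HF GK scalerA -exprD -mulSnr expCi_mod4 modnMr.
  by rewrite expr0 scale1r.
suff -> : g = 'i ^+ (k + 3 * f (G w)) *: P (G w) by exact: pauli_group_exp.
by apply: (conj_inj hU); rewrite exprD -scalerA conj_scale E.
Qed.

End Main.

Theorem theorem2 (R : realType) (n : nat) (n_gt0 : (0 < n)%N)
    (B1 B2 : 'I_(2 ^ n).+1 -> 'M[R[i]]_(2 ^ n))
    (hB1 : pauli_MUB B1) (hB2 : pauli_MUB B2)
    (U : 'M[R[i]]_(2 ^ n)) (hU : U \is unitarymx)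
    (hUB : maps_bases U B1 B2) :
  exists (c : R[i]) (V : 'M[R[i]]_(2 ^ n)),
    [/\ `|c| = 1, clifford V & U = c *: V].
Proof.
(* Conjugation is blind to a global phase, so U itself serves as V. *)
exists 1, U; split; rewrite ?normr1 ?scale1r //.
exact: (maps_bases_clifford n_gt0 hB1 hB2 hU hUB).
Qed.
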